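(* Let $C\ge 1$, $\alpha\in(0,1)$, and let $(\mathbb{P}_n)_{n\ge 0}$ be a prefix-heavy sequence of measures on tuples of reduced words with parameters $(C,\alpha)$. If there exists a sequence $(\eta_n)_{n\ge 0}$ of positive real numbers such that $$\lim_{n\to\infty}\mathbb{P}_n\left(\mathsf{size}^2\,\mathsf{max}^2\,\alpha^{\frac{\mathsf{min}}{8}}>\eta_n\right)=0\quad\text{and}\quad \lim_{n\to\infty}\eta_n=0,$$ then a random tuple of words generically generates a malnormal subgroup of $F(A)$. Moreover, if both of these limits converge polynomially (resp. super-polynomially, exponentially) fast, i.e. both sequences are polynomially (resp. super-polynomially, exponentially) small, then malnormality holds polynomially (resp. super-polynomially, exponentially) generically.
   Context: $A$ is a finite non-empty alphabet, $\tilde A=A\sqcup A^{-1}$, and $F(A)$ is the free group on $A$, identified with the set $\mathcal{R}$ of all reduced words over $\tilde A$ (words with no factor $aa^{-1}$, $a\in\tilde A$), including the empty word. $\mathcal{R}_n$ is the set of reduced words of length $n$. For $u\in\mathcal{R}$, $\mathcal{P}(u)$ is the set of reduced words having $u$ as a prefix (empty if $u$ is not reduced). A sequence $(\mathbb{R}_n)_{n\ge0}$ of probability measures on $\mathcal{R}$ is prefix-heavy with parameters $(C,\alpha)$ ($C\ge1$, $0<\alpha<1$) if (1) the support of $\mathbb{R}_n$ is contained in $\mathcal{R}_n$ for every $n$, and (2) for every $n\ge0$ and $u\in\mathcal{R}$ with $\mathbb{R}_n(\mathcal{P}(u))\ne0$, and every $v\in\mathcal{R}$, $\mathbb{R}_n(\mathcal{P}(uv)\mid\mathcal{P}(u))\le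 C\alpha^{|v|}$ (where $uv$ is the concatenation). A prefix-heavy sequence of measures on tuples of reduced words with parameters $(C,\alpha)$ is a sequence $(\mathbb{P}_n)_{n\ge0}$ of probability measures on the set of all finite tuples of reduced words such that $\mathbb{P}_n(h_1,\dots,h_k)=\mathbb{T}_n(|h_1|,\dots,|h_k|)\prod_{i=1}^k\mathbb{R}_{|h_i|}(h_i)$, where $(\mathbb{T}_n)_n$ is a sequence of probability measures on the set of finite tuples (of size $k \geq 1$) of non-negative integers and $(\mathbb{R}_n)_n$ is a prefix-heavy sequence of measures on $\mathcal{R}$ with parameters $(C,\alpha)$. For a tuple $\vec h=(h_1,\dots,h_k)$: $\mathsf{size}(\vec h)=k$, $\mathsf{min}(\vec h)=\min_i|h_i|$, $\mathsf{max}(\vec h)=\max_i|h_i|$. A subgroup $H$ of a group $G$ is malnormal if $H\cap g^{-1}Hg$ is trivial for every $g\in G\setminus H$. A property holds generically if the $\mathbb{P}_n$-probability of its failure tends to $0$; it holds exponentially (resp. super-polynomially, polynomially) generically if this probability is exponentially (resp. super-polynomially, polynomially) small. A function $g$ with limit $0$ is exponentially small if $g(n)=o(e^{-dn})$ for some $d>0$; super-polynomially small if $g(n)=o(n^{-d})$ for every positive integer $d$; polynomially small if $g(n)=o(n^{-d})$ for some positive integer $d$. *)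

(* Defs.v *)
From HB Require Import structures.
From mathcomp Require Import all_boot all_order all_algebra.
From mathcomp Require Import all_classical all_reals all_analysis.

Set Implicit Arguments.
Unset Strict Implicit.
Unset Printing Implicit Defensive.

Import Order.TTheory GRing.Theory Num.Theory.
Import numFieldNormedType.Exports.

Local Open Scope classical_set_scope.
Local Open Scope ring_scope.

(* The alphabet A together with its formal inverses: [(a, false)] stands for
   the letter a and [(a, true)] for its inverse. *)
Notation letter A := (A * bool)%type.

Definition linv (A : finType) (x : letter A) : letter A := (x.1, ~~ x.2).

Definition reduced (A : finType) (w : seq (letter A)) : bool :=
  sorted (fun x y => y != linv x) w.

Record freeGroup (A : finType) : Type :=
  FreeGroup { word : seq (letter A); word_reduced : reduced word }.

HB.instance Definition _ (A : finType) := [isSub for @word A].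
HB.instance Definition _ (A : finType) := [Countable of freeGroup A by <:].

Section FreeGroupTheory.
Variable A : finType.
Implicit Types (a : letter A) (u v w : seq (letter A)).

Lemma linvK : involutive (@linv A).
Proof. by case=> a b; rewrite /linv /= negbK. Qed.

Definition cons_letter a w : seq (letter A) :=
  if w is b :: w' then if b == linv a then w' else a :: w else [:: a].

(* Cancels all factors x x^-1; the result is the reduced word representing w. *)
Definition reduce w : seq (letter A) := foldr cons_letter [::] w.

Definition invw w : seq (letter A) := rev (map (@linv A) w).

Lemma reduced_behead a w : reduced (a :: w) -> reduced w.
Proof. exact: path_sorted. Qed.

Lemma cons_letter_reduced a w : reduced w -> reduced (cons_letter a w).
Proof.
case: w => [|b w] //= rw; case: ifPn => [_|ba]; first exact: reduced_behead rw.
by rewrite /reduced /= ba.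
Qed.

Lemma foldr_reduced u w : reduced w -> reduced (foldr cons_letter w u).
Proof. by move=> rw; elim: u => //= a u; exact: cons_letter_reduced. Qed.

Lemma reduce_reduced w : reduced (reduce w).
Proof. exact: foldr_reduced. Qed.

Lemma reduce_id w : reduced w -> reduce w = w.
Proof.
elim: w => //= a w IHw rw; rewrite (IHw (reduced_behead rw)).
by case: w rw {IHw} => //= b w; rewrite /reduced /= => /andP[/negPf-> _].
Qed.

Lemma cons_letterK a w :
  reduced w -> cons_letter a (cons_letter (linv a) w) = w.
Proof.
case: w => [|b w] rw /=; first by rewrite eqxx.
rewrite linvK; case: eqP => [eb|_] /=; last by rewrite eqxx.
rewrite {}eb in rw *; case: w rw => [|c w] //=.
by rewrite /reduced /= => /andP[/negPf ->].
Qed.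

Lemma foldr_reduce u w :
  reduced w -> foldr cons_letter w (reduce u) = foldr cons_letter w u.
Proof.
move=> rw; elim: u => //= a u <-; move: (reduce u) => [|b s] //=.
by case: eqP => //= ->; rewrite cons_letterK //; exact: foldr_reduced.
Qed.

Lemma reduce_catr u v : reduce (u ++ reduce v) = reduce (u ++ v).
Proof. by rewrite /reduce !foldr_cat -/(reduce _) reduce_id// reduce_reduced. Qed.

Lemma reduce_catl u v : reduce (reduce u ++ v) = reduce (u ++ v).
Proof. by rewrite {1 3}/reduce !foldr_cat foldr_reduce// reduce_reduced. Qed.

Lemma invwK : involutive invw.
Proof.
move=> w; rewrite /invw map_rev revK -map_comp map_id_in// => x _ /=.
exact: linvK.
Qed.

Lemma invw_reduced w : reduced w -> reduced (invw w).
Proof.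
rewrite /reduced /invw rev_sorted sorted_map.
apply: sub_sorted => x y /=; rewrite (can_eq linvK).
by apply: contraNneq => e; rewrite -[y]linvK -e.
Qed.

Lemma reduce_invw w : reduce (invw w ++ w) = [::].
Proof.
elim: w => //= a w IHw; rewrite /invw map_cons rev_cons cat_rcons.
rewrite -IHw /reduce !foldr_cat; congr foldr.
have /(cons_letterK (linv a)) := reduce_reduced w; rewrite linvK; exact.
Qed.

Implicit Types x y z : freeGroup A.

Definition fg_one : freeGroup A := @FreeGroup A [::] isT.
Definition fg_mul x y : freeGroup A :=
  FreeGroup (reduce_reduced (word x ++ word y)).
Definition fg_inv x : freeGroup A := FreeGroup (invw_reduced (word_reduced x)).

Lemma fg_mulA : associative fg_mul.
Proof. by move=> x y z; apply: val_inj; rewrite /= reduce_catr reduce_catl catA. Qed.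

Lemma fg_mul1 : left_id fg_one fg_mul.
Proof. by move=> x; apply: val_inj; rewrite /= reduce_id// word_reduced. Qed.

Lemma fg_mulr1 : right_id fg_one fg_mul.
Proof.
by move=> x; apply: val_inj; rewrite /= cats0 reduce_id// word_reduced.
Qed.

Lemma fg_mulV : left_inverse fg_one fg_inv fg_mul.
Proof. by move=> x; apply: val_inj; rewrite /= reduce_invw. Qed.

Lemma fg_mulrV : right_inverse fg_one fg_inv fg_mul.
Proof.
by move=> x; apply: val_inj; rewrite /= -{1}[word x]invwK reduce_invw.
Qed.

End FreeGroupTheory.

HB.instance Definition _ (A : finType) := isGroup.Build (freeGroup A)
  (@fg_mulA A) (@fg_mul1 A) (@fg_mulr1 A) (@fg_mulV A) (@fg_mulrV A).

Definition wlen (A : finType) (x : freeGroup A) : nat := size (word x).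

(* All events on words and on tuples are measurable: these countable types
   carry the discrete sigma-algebra. *)
HB.instance Definition _ (A : finType) :=
  isPointed.Build (freeGroup A) (fg_one A).
HB.instance Definition _ (A : finType) :=
  @isMeasurable.Build default_measure_display (freeGroup A)
    discrete_measurable discrete_measurable0
    discrete_measurableC discrete_measurableU.
HB.instance Definition _ (T : countType) := isPointed.Build (seq T) [::].
HB.instance Definition _ (T : countType) :=
  @isMeasurable.Build default_measure_display (seq T)
    discrete_measurable discrete_measurable0
    discrete_measurableC discrete_measurableU.

Section Subgroups.
Variable G : groupType.

Definition is_subgroup (H : set G) : Prop :=
  H 1%g /\ forall x y, H x -> H y -> H (x * y^-1)%g.

Definition generated (S : set G) : set G := smallest is_subgroup S.

Definition malnormal (H : set G) : Prop :=
  forall g, ~ H g -> H `&` [set (g^-1 * x * g)%g | x in H] = [set 1%g].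

End Subgroups.

Section Measures.
Variables (R : realType) (A : finType).
Implicit Types (C alpha : R).

(* The words with prefix u, for an arbitrary word u: it is empty when u is not
   reduced, since a prefix of a reduced word is reduced. *)
Definition with_prefix (u : seq (letter A)) : set (freeGroup A) :=
  [set x | prefix u (word x)].

Definition cond_prob d (T : measurableType d) (P : probability T R)
    (E F : set T) : R :=
  fine (P (E `&` F)) / fine (P F).

Definition prefix_heavy C alpha (Rn : nat -> probability (freeGroup A) R) :=
  (forall n x, Rn n [set x] != 0%E -> wlen x = n) /\
  (forall n (u : freeGroup A), Rn n (with_prefix (word u)) != 0%E ->
   forall v : freeGroup A,
     cond_prob (Rn n) (with_prefix (word u ++ word v)) (with_prefix (word u))
       <= C * alpha ^+ wlen v).

Definition prefix_heavy_tuples C alpha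
    (P : nat -> probability (seq (freeGroup A)) R) : Prop :=
  exists (T : nat -> probability (seq nat) R)
         (Rn : nat -> probability (freeGroup A) R),
    [/\ forall n, T n [set [::]] = 0%E,
        prefix_heavy C alpha Rn
      & forall n (h : seq (freeGroup A)),
          P n [set h] = (T n [set map (@wlen A) h] *
                         \prod_(x <- h) Rn (wlen x) [set x])%E].

End Measures.

Definition max_len (A : finType) (h : seq (freeGroup A)) : nat :=
  \max_(x <- h) wlen x.

(* The starting value [max_len h] is neutral when h is not empty. *)
Definition min_len (A : finType) (h : seq (freeGroup A)) : nat :=
  \big[minn/max_len h]_(x <- h) wlen x.

Definition generates_malnormal (A : finType) : set (seq (freeGroup A)) :=
  [set h | malnormal (generated [set x | x \in h])].

Section Asymptotics.
Variable R : realType.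
Implicit Types g : nat -> R.

Definition tends_to_0 g : Prop := g @ \oo --> (0 : R).

Definition exponentially_small g : Prop :=
  tends_to_0 g /\
  exists2 d : R, 0 < d & g =o_\oo (fun n => expR (- d * n%:R)).

Definition super_polynomially_small g : Prop :=
  tends_to_0 g /\
  forall d : nat, (0 < d)%N -> g =o_\oo (fun n => (n%:R ^- d : R)).

Definition polynomially_small g : Prop :=
  tends_to_0 g /\
  exists2 d : nat, (0 < d)%N & g =o_\oo (fun n => (n%:R ^- d : R)).

Variables (d : measure_display) (T : measurableType d).
Variables (P : nat -> probability T R) (E : set T).

Definition failure_prob : nat -> R := fun n => fine (P n (~` E)).

Definition generically : Prop := tends_to_0 failure_prob.
Definition exponentially_generically : Prop :=
  exponentially_small failure_prob.
Definition super_polynomially_generically : Prop :=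
  super_polynomially_small failure_prob.
Definition polynomially_generically : Prop := polynomially_small failure_prob.

End Asymptotics.

(* Main.v *)
Require Import Defs.
From mathcomp Require Import all_boot all_order all_algebra.
From mathcomp Require Import all_classical all_reals all_analysis.
From mathcomp Require Import zify lra.

Set Implicit Arguments.
Unset Strict Implicit.
Unset Printing Implicit Defensive.

Import Order.TTheory GRing.Theory Num.Theory.
Import numFieldNormedType.Exports.

Local Open Scope classical_set_scope.
Local Open Scope ring_scope.

(** Let t be a quarter of the minimal length.  If the factors of length t of the
    generators and of their inverses occur each at a single place, then at most
    t - 1 letters cancel between consecutive generators.  A long reduced word
    of H therefore contains long factors of generators at bounded distances.
    If y and g y g^-1 both lie in H, then after replacing y by a high power
    their words share such a factor; as it occurs only once in the generators,
    both words are at the same vertex of the Stallings graph of H there, which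
    forces g into H.
    Conversely, for fixed lengths, an occurrence of the same factor at two given
    places (up to inversion) has probability at most C alpha^t, because the t
    letters at the later place are determined by the preceding ones, or by the
    other word.  There are at most 2 size^2 max^2 pairs of places,
    and summing over the lengths bounds the failure probability by
    q n + (2 C / alpha) eta n. *)

(** * Words of the free group and cancellation in products *)

Section Words.
Variable A : finType.
Implicit Types (u v w : seq (letter A)) (x y g : freeGroup A).

Definition of_word w : freeGroup A := FreeGroup (reduce_reduced w).

Lemma wordK x : of_word (word x) = x.
Proof. by apply: val_inj; rewrite /= reduce_id// word_reduced. Qed.

Lemma of_word_cat u v : of_word (u ++ v) = (of_word u * of_word v)%g.
Proof. by apply: val_inj; rewrite /= reduce_catl reduce_catr. Qed.

Lemma of_word_inv u : of_word (invw u) = (of_word u)^-1%g.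
Proof.
rewrite -[LHS]invgK; congr (_^-1)%g; apply: mulg1_eq.
by rewrite -of_word_cat; apply: val_inj => /=; exact: reduce_invw.
Qed.

Lemma size_invw u : size (invw u) = size u.
Proof. by rewrite size_rev size_map. Qed.

Lemma invw_rcons u a : invw (rcons u a) = linv a :: invw u.
Proof. by rewrite /invw map_rcons rev_rcons. Qed.

Lemma invw_cat u v : invw (u ++ v) = invw v ++ invw u.
Proof. by rewrite /invw map_cat rev_cat. Qed.

Lemma reduced_take n u : reduced u -> reduced (take n u).
Proof. exact: take_sorted. Qed.

Lemma reduced_drop n u : reduced u -> reduced (drop n u).
Proof. exact: drop_sorted. Qed.

(** While the last letter of [u] and the first letter of [v] are mutually inverse, both are removed;
    [c] counts the removed pairs, so the last [c] letters of [u] spell the inverse of the first [c]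
    letters of [v]. *)
Lemma reduce_cat_cancel u v : reduced u -> reduced v ->
  exists c, [/\ (c <= size u)%N, (c <= size v)%N,
    invw (drop (size u - c) u) = take c v
  & reduce (u ++ v) = take (size u - c) u ++ drop c v].
Proof.
elim/last_ind: u v => [|u a IHu] v ru rv.
  by exists 0; rewrite /= take0 drop0 reduce_id.
case: v rv => [|b v] rv.
  by exists 0; rewrite cats0 subn0 take_size drop_size cats0 reduce_id.
have [eb|neb] := eqVneq b (linv a); last first.
  exists 0; rewrite subn0 take_size drop_size take0 drop0; split=> //.
  apply: reduce_id; move: ru rv neb; rewrite /reduced.
  case: u {IHu} => [|c u] /=; first by move=> _ -> ->.
  by rewrite cat_path last_rcons /= => -> -> ->.
have [||c [cu cv e1 e2]] := IHu v.
- by move: (reduced_take (size u) ru); rewrite -cats1 take_size_cat.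
- exact: reduced_behead rv.
exists c.+1; rewrite size_rcons !ltnS subSS; split=> //.
- rewrite drop_rcons ?leq_subr// invw_rcons e1 /=; by rewrite eb.
- rewrite -cats1 takel_cat ?leq_subr//= -e2 -catA /reduce !foldr_cat /= eb.
  by rewrite cons_letterK// -/(reduce _) reduce_reduced.
Qed.

Lemma mul_cancel x y : exists c, [/\ (c <= wlen x)%N, (c <= wlen y)%N,
    invw (drop (wlen x - c) (word x)) = take c (word y)
  & word (x * y)%g = take (wlen x - c) (word x) ++ drop c (word y)].
Proof. exact: reduce_cat_cancel (word_reduced x) (word_reduced y). Qed.

(* A reduced word cannot coincide with its inverse at its centre, i.e. at two
   equal or adjacent positions. *)
Lemma reduced_center a0 u i j : reduced u -> (i <= j <= i.+1)%N ->
  (j < size u)%N -> nth a0 u j <> linv (nth a0 u i).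
Proof.
move=> ru /andP[ij ji] ju e.
have [eij|nij] := eqVneq i j.
  by move: e; rewrite eij; case: (nth a0 u j) => a []; rewrite /linv.
have ej : j = i.+1 by lia.
move: ru; rewrite /reduced => /(sortedP a0) /(_ i); rewrite -ej ju => /(_ isT).
by rewrite e eqxx.
Qed.

Lemma nth_invw a0 u i : (i < size u)%N ->
  nth a0 (invw u) i = linv (nth a0 u (size u - i.+1)).
Proof.
move=> iu; rewrite /invw nth_rev ?size_map// (nth_map a0)//; lia.
Qed.

(** If at least half of [x] cancelled in [x * x], the cancelled prefix would reach the centre of
    [x], where [x] would coincide with its own inverse. So fewer than half of the letters cancel on
    each side. *)
Lemma wlen_sqr x : x != 1%g -> (wlen x < wlen (x * x)%g)%N.
Proof.
move=> x1; have [c [cx _ e1 e2]] := mul_cancel x x.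
have x0 : (0 < wlen x)%N.
  rewrite lt0n; apply: contra x1 => /nilP e; apply/eqP/val_inj; exact: e.
have -> : wlen (x * x)%g = (wlen x - c + (wlen x - c))%N.
  rewrite {1}/wlen e2 size_cat size_drop size_take_min.
  by congr addn; apply/minn_idPl; apply: leq_subr.
suff : (c.*2 < wlen x)%N by lia.
rewrite ltnNge; apply/negP => hc.
case ew : (word x) => [|a0 s]; first by move: x0; rewrite /wlen ew.
set n := wlen x in cx x0 hc e1 *.
(* The two central positions, equal when [n] is odd; in both cases [i + j = n - 1], so inversion
   exchanges them. *)
pose i := (n.-1 %/ 2)%N; pose j := (n %/ 2)%N.
have jc : (j < size (word x))%N by rewrite -/(wlen x) -/n /j; lia.
have ic : (i < c)%N by rewrite /i; lia.
apply: (@reduced_center a0 (word x) i j (word_reduced x) _ jc).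
  by rewrite /i /j; lia.
have := congr1 (fun s => nth a0 s i) e1.
rewrite /= nth_take// nth_invw; last by rewrite size_drop -/(wlen x) -/n; lia.
rewrite size_drop nth_drop -/(wlen x) -/n => <-; rewrite linvK.
congr nth; rewrite /i /j; lia.
Qed.

End Words.

(** * Subgroups generated by a set *)

Section SubgroupTheory.
Variable G : groupType.
Implicit Types H X : set G.

Lemma subgroupV H x : is_subgroup H -> H x -> H x^-1%g.
Proof. by move=> [H1 HB] Hx; rewrite -[x^-1%g]mul1g; exact: HB. Qed.

Lemma subgroupM H x y : is_subgroup H -> H x -> H y -> H (x * y)%g.
Proof. by move=> Hs Hx Hy; rewrite -[y]invgK; apply: Hs.2 => //; exact: subgroupV. Qed.

Lemma generated_subgroup X : is_subgroup (generated X).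
Proof.
split; first by move=> H [[H1 _] _].
move=> x y Hx Hy H HX; apply: (HX.1).2; [exact: Hx|exact: Hy].
Qed.

Lemma sub_generated X : X `<=` generated X.
Proof. exact: sub_smallest. Qed.

Lemma generated_min H X : is_subgroup H -> X `<=` H -> generated X `<=` H.
Proof. by move=> Hs XH x; apply. Qed.

(** The products of lists over [X] form a subgroup: the inverse of a product is the reversed product
    of inverses, which again lie in [X]. *)
Lemma generated_prod X : (forall x, X x -> X x^-1%g) ->
  forall x, generated X x ->
  exists l, (forall y, y \in l -> X y) /\ (\prod_(y <- l) y = x)%g.
Proof.
move=> X_inv x Hx.
pose K := [set x | exists l, (forall y, y \in l -> X y) /\ (\prod_(y <- l) y = x)%g].
apply: (Hx K); split; last first.
  move=> y Xy; exists [:: y]; rewrite big_seq1; split=> // z.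
  by rewrite inE => /eqP ->.
split; first by exists [::]; rewrite big_nil.
move=> _ _ [l1 [Xl1 <-]] [l2 [Xl2 <-]].
exists (l1 ++ rev (map (fun y => y^-1%g) l2)); split.
  move=> y; rewrite mem_cat mem_rev => /orP[/Xl1//|/mapP[z /Xl2 Xz ->]].
  exact: X_inv.
by rewrite big_cat -map_rev big_map prodgV revK.
Qed.

End SubgroupTheory.

(** * Long factors of generators inside products of generators *)

Section SmallCancellation.
Variable A : finType.
Implicit Types (u v w : seq (letter A)) (x y g : freeGroup A).

Definition factor n p w : seq (letter A) := take n (drop p w).

Lemma factor_factor m n p q w : (q + m <= n)%N ->
  factor m q (factor n p w) = factor m (p + q) w.
Proof.
move=> qmn; rewrite /factor; have -> : n = (n - q + q)%N by lia.
by rewrite -take_drop drop_drop take_takel ?(addnC q)//; lia.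
Qed.

Lemma factor_cat_take n p c u v : (p + n <= c)%N -> (c <= size u)%N ->
  factor n p (take c u ++ v) = factor n p u.
Proof.
move=> pnc cu; rewrite /factor drop_cat size_takel//.
have -> : drop p (take c u) = take (c - p) (drop p u).
  by rewrite take_drop subnK//; lia.
have [pc|cp] := ltnP p c.
  rewrite takel_cat; last by rewrite size_takel ?size_drop; lia.
  by rewrite take_takel//; lia.
have -> : n = 0%N by lia.
by rewrite !take0.
Qed.

Variables (S H : set (freeGroup A)) (t : nat).
Hypotheses (S_inv : forall x, S x -> S x^-1%g)
  (S_long : forall x, S x -> (4 * t <= wlen x)%N)
  (S_factor : forall x y p q, S x -> S y ->
     (p + t <= wlen x)%N -> (q + t <= wlen y)%N ->
     factor t p (word x) = factor t q (word y) -> x = y /\ p = q).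
Hypotheses (H_subgroup : is_subgroup H) (S_sub_H : S `<=` H).

(* In the Stallings graph of [H], the letters of [x] at positions [b], ...,
   [b + n - 1] are read along the loop labelled [y]. *)
Definition read_at x n b := exists y q h, [/\ S y, H h, (q + n <= wlen y)%N,
  factor n b (word x) = factor n q (word y) &
  of_word (take b (word x)) = (h * of_word (take q (word y)))%g].

Lemma read_atW m n k x b : (k + m <= n)%N ->
  read_at x n b -> read_at x m (b + k)%N.
Proof.
move=> kmn [y [q [h [Sy Hh qn e1 e2]]]]; exists y, (q + k)%N, h; split=> //.
- by lia.
- by rewrite -(factor_factor _ _ kmn) e1 factor_factor.
(* The first [k] letters of the window are common to [x] and [y], so both prefixes are extended by
   the same word and [h] is unchanged. *)
rewrite !takeD !of_word_cat e2 -mulgA; do 2 congr (_ * _)%g; congr of_word.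
have kn : (0 + k <= n)%N by lia.
by rewrite -/(factor k b _) -/(factor k q _) -[b]addn0 -(factor_factor _ _ kn) e1 factor_factor// addn0.
Qed.

(** The analogue of [reduced] for lists of group elements. *)
Definition nielsen := sorted (fun x y => y != x^-1%g).

(** Induction on the list. Fewer than [t] letters cancel at each junction, so all but the last [t]
    letters of the first generator survive at the head of the product; this locates [y] in the
    remaining product at the next step. As generators have length at least [4 * t], a window of
    length [n <= 2 * t] fits between the two cancelled ends of one. *)
Lemma read_window n x l a : (n <= 2 * t)%N ->
  nielsen (x :: l) -> (forall y, y \in x :: l -> S y) ->
  let z := (\prod_(y <- x :: l) y)%g in
  [/\ (wlen x - t <= wlen z)%N,
    take (wlen x - t) (word z) = take (wlen x - t) (word x)
  & (a + 2 * n <= wlen z)%N ->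
    exists b, (a <= b <= a + n)%N /\ read_at z n b].
Proof.
move=> nt; elim: l x a => [|y l IHl] x a.
  move=> _ Sl; rewrite big_seq1 /= leq_subr; split=> // ax.
  exists a; split; first by lia.
  exists x, a, 1%g; rewrite mul1g; split=> //; try exact: H_subgroup.1; last by lia.
  by apply: Sl; rewrite inE.
move=> /=/andP[yx nl] Sl; rewrite big_cons.
have Sx : S x by apply: Sl; rewrite inE eqxx.
have Sy : S y by apply: Sl; rewrite !inE eqxx orbT.
have {}IHl a' := IHl y a' nl (fun z zl => Sl z (@mem_behead _ (x :: y :: l) z zl)).
set z := (\prod_(y <- y :: l) y)%g in IHl *; set z' := (x * z)%g.
have [yz zy _] := IHl 0.
have [c [cx cz e1 e2]] := mul_cancel x z; rewrite -/z' in e2.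
have lx := S_long Sx; have ly := S_long Sy.
have fz m p : (p + m <= wlen y - t)%N ->
    factor m p (word z) = factor m p (word y).
  move=> pm; rewrite -(cat_take_drop (wlen y - t) (word z)) zy.
  by rewrite factor_cat_take// leq_subr.
(* If [t] letters cancelled, [y] and [x^-1] would have the same first [t] letters; uniqueness of
   factors would give [y = x^-1], which [nielsen] excludes. *)
have ct : (c < t)%N.
  rewrite ltnNge; apply/negP => tc; move: yx; apply/negP/negPn/eqP.
  have [] // := @S_factor y x^-1%g 0 0 Sy (S_inv Sx).
  - by lia.
  - by rewrite /wlen size_invw -/(wlen x); lia.
  rewrite -fz; last by lia.
  rewrite /factor !drop0 -(take_takel _ tc) -e1 /=.
  rewrite -[in RHS](cat_take_drop (wlen x - c) (word x)) invw_cat takel_cat//.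
  by rewrite size_invw size_drop -/(wlen x); lia.
have sx : size (take (wlen x - c) (word x)) = (wlen x - c)%N.
  by rewrite size_takel// leq_subr.
have sz : wlen z' = (wlen x - c + (wlen z - c))%N.
  by rewrite /wlen e2 size_cat size_drop sx.
split; first by lia.
  by rewrite e2 takel_cat ?sx ?take_takel//; lia.
(* The junction is at position [wlen x - c]. If it is not before [a + n], the window at [a] lies in
   [x]; if it is not after [a], the induction hypothesis gives a window of [z], which [shift]
   carries over; otherwise the window starts at the junction and lies in [y], because
   [c + n <= 3 * t <= wlen y - t]. *)
move=> az.
have [anx|nax] := leqP (a + n) (wlen x - c).
  exists a; split; first by lia.
  exists x, a, 1%g; rewrite mul1g; split=> //; try exact: H_subgroup.1; first by lia.
    by rewrite e2 factor_cat_take// leq_subr.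
  by rewrite e2 takel_cat ?take_takel ?sx//; lia.
have ex : of_word (take (wlen x - c) (word x)) = (x * of_word (take c (word z)))%g.
  rewrite -e1 of_word_inv -[X in (X * _)%g](wordK x).
  by rewrite -[in X in (X * _)%g](cat_take_drop (wlen x - c) (word x)) of_word_cat mulgK.
have shift b : (c <= b)%N -> read_at z n b -> read_at z' n (wlen x - c + (b - c))%N.
  move=> cb [u [q [h [Su Hh qu e3 e4]]]]; exists u, q, (x * h)%g.
  split=> //; first by apply: subgroupM => //; exact: S_sub_H.
    rewrite -e3 /factor e2 drop_cat sx ltnNge leq_addr/= drop_drop.
    by congr (take _ (drop _ _)); lia.
  rewrite -mulgA -e4 e2 take_cat sx ltnNge leq_addr/= of_word_cat ex -mulgA.
  rewrite -of_word_cat; congr (_ * of_word _)%g.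
  rewrite -[in RHS](cat_take_drop c (word z)) take_cat size_takel// ltnNge cb/=.
  by congr (_ ++ take _ _); lia.
have [xa|ax] := leqP (wlen x - c) a.
  have [_ _ []] := IHl (a - (wlen x - c) + c)%N; first by lia.
  move=> b [ab rb]; exists (wlen x - c + (b - c))%N; split; first by lia.
  by apply: shift => //; lia.
exists (wlen x - c + (c - c))%N; split; first by lia.
apply: shift => //; exists y, c, 1%g; rewrite mul1g; split=> //; try exact: H_subgroup.1; first by lia.
  by rewrite fz//; lia.
rewrite -(@take_takel _ c (wlen y - t) (word z)); last by lia.
by rewrite zy take_takel//; lia.
Qed.

(** Multiplying by a generator on the left either prepends it or deletes a head inverse to it. *)
Lemma mul_nielsen x l : nielsen l -> (forall y, y \in l -> S y) -> S x ->
  exists l', [/\ nielsen l', forall y, y \in l' -> S y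
    & (\prod_(y <- l') y = x * \prod_(y <- l) y)%g].
Proof.
case: l => [|y l] nl Sl Sx.
  exists [:: x]; split=> //; last by rewrite big_seq1 big_nil mulg1.
  by move=> y; rewrite inE => /eqP ->.
have [yx|yx] := eqVneq y x^-1%g.
  exists l; split.
  - exact: path_sorted nl.
  - by move=> z zl; apply: Sl; rewrite inE zl orbT.
  - by rewrite big_cons yx mulVKg.
exists [:: x, y & l]; split; last by rewrite big_cons.
- by rewrite /nielsen /= yx.
- by move=> z; rewrite inE => /predU1P[-> //|/Sl].
Qed.

Lemma nielsen_prod l : (forall y, y \in l -> S y) ->
  exists l', [/\ nielsen l', forall y, y \in l' -> S y
    & (\prod_(y <- l') y = \prod_(y <- l) y)%g].
Proof.
elim: l => [|x l IHl] Sl; first by exists [::].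
have [|l' [nl' Sl' e]] := IHl; first by move=> y yl; apply: Sl; rewrite inE yl orbT.
have [|l'' [nl'' Sl'' e']] := mul_nielsen nl' Sl' (x := x).
  by apply: Sl; rewrite inE eqxx.
by exists l''; split=> //; rewrite e' e big_cons.
Qed.

End SmallCancellation.

(** * Malnormality when factors of generators occur only once *)

Section Malnormality.
Variable A : finType.
Implicit Types (x y g : freeGroup A).
Variables (S : set (freeGroup A)) (t : nat).
Hypotheses (S_inv : forall x, S x -> S x^-1%g)
  (S_long : forall x, S x -> (4 * t <= wlen x)%N)
  (S_factor : forall x y p q, S x -> S y ->
     (p + t <= wlen x)%N -> (q + t <= wlen y)%N ->
     factor t p (word x) = factor t q (word y) -> x = y /\ p = q).

Lemma generated_read_window n x a : (n <= 2 * t)%N -> generated S x -> x != 1%g ->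
  (a + 2 * n <= wlen x)%N ->
  exists b, (a <= b <= a + n)%N /\ read_at S (generated S) x n b.
Proof.
move=> nt Hx x1 ax; have [l [Sl el]] := generated_prod S_inv Hx.
have [[|y l'] [nl' Sl' e]] := nielsen_prod Sl.
  by move: x1; rewrite -el -e big_nil eqxx.
rewrite el in e; rewrite -e in ax *.
have [_ _] := read_window S_inv S_long S_factor (generated_subgroup S)
  (@sub_generated _ S) a nt nl' Sl'.
exact.
Qed.

(* Squaring makes [x] and [g x g^-1] as long as needed, and then their words
   share a factor longer than a window: an occurrence read in both along the
   same generator at the same place identifies the cosets [g H] and [H]. *)
Lemma malnormal_generated : malnormal (generated S).
Proof.
have Hs := generated_subgroup S.
move=> g Hg; apply/seteqP; split=> [y|_ ->]; last first.
  split; first exact: Hs.1.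
  by exists 1%g; [exact: Hs.1 | rewrite mulg1 mulVg].
move=> [/= Hy [x Hx exy]]; apply/eqP; apply: contra_notT Hg => y1.
have {x Hx exy} Hgy : generated S (g * y * g^-1)%g.
  by rewrite -exy !mulgA mulgV mul1g mulgK.
(* At most [wlen g] letters cancel at either end of [y] in [g * y * g^-1], so [4 * t] consecutive
   letters of [y] survive: enough to search for a window of length [2 * t]. *)
have {y Hy y1 Hgy} [y [Hy Hgy y1 ly]] : exists y, [/\ generated S y,
    generated S (g * y * g^-1)%g, y != 1%g & (2 * wlen g + 4 * t <= wlen y)%N].
  elim: (_ + _)%N => [|n [z [Hz Hgz z1 lz]]]; first by exists y.
  exists (z * z)%g; have lzz := wlen_sqr z1; split; last by lia.
  - exact: (subgroupM Hs).
  - suff -> : (g * (z * z) * g^-1 = (g * z * g^-1) * (g * z * g^-1))%g.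
      exact: (subgroupM Hs).
    by rewrite !mulgA mulgVK.
  - by apply: contraTneq lzz => ->; rewrite -leqNgt.
set x := (g * y * g^-1)%g in Hgy.
have x1 : x != 1%g.
  apply: contra y1 => /eqP e; rewrite -[y](mulKg g) -[(g * y)%g](mulgK g^-1%g).
  by rewrite -/x e invgK mul1g mulVg.
have [c [cg cy e1 e2]] := mul_cancel g y.
have [d [dgy dg _ e4]] := mul_cancel (g * y)%g g^-1%g; rewrite -/x in e4.
have {}dg : (d <= wlen g)%N by rewrite /wlen size_invw in dg.
have lg : size (take (wlen g - c) (word g)) = (wlen g - c)%N.
  by rewrite size_takel// leq_subr.
have lgy : wlen (g * y)%g = (wlen g - c + (wlen y - c))%N.
  by rewrite /wlen e2 size_cat lg size_drop.
have lx : (wlen (g * y)%g - d <= wlen x)%N.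
  by rewrite /wlen e4 size_cat size_takel ?leq_subr ?leq_addr.
have fx n k : (k + n <= wlen y - c - d)%N ->
    factor n (wlen g - c + k) (word x) = factor n (c + k) (word y).
  move=> kn; rewrite e4 factor_cat_take ?leq_subr//; last by rewrite lgy; lia.
  rewrite e2 /factor drop_cat lg ltnNge leq_addr/= drop_drop.
  by congr (take _ (drop _ _)); lia.
have ex k : (k <= wlen y - c - d)%N ->
    of_word (take (wlen g - c + k) (word x)) = (g * of_word (take (c + k) (word y)))%g.
  move=> kn; rewrite e4 takel_cat; last by rewrite size_takel ?leq_subr// lgy; lia.
  rewrite take_takel; last by rewrite lgy; lia.
  rewrite e2 take_cat lg ltnNge leq_addr/= addKn of_word_cat takeD of_word_cat.
  rewrite mulgA; congr (_ * _)%g.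
  rewrite -e1 of_word_inv -[X in (X * _)%g](wordK g).
  by rewrite -[in X in (X * _)%g](cat_take_drop (wlen g - c) (word g)) of_word_cat mulgK.
have [|b [ab rb]] := generated_read_window (a := (wlen g - c)%N) (leqnn (2 * t)) Hgy x1.
  by lia.
have t2 : (t <= 2 * t)%N by lia.
(* This window of [y], of length [t], starts at most [t] letters after the place matching [b], hence
   lies inside the window of length [2 * t] found in [x]. *)
have [|e [ae re]] := generated_read_window (a := (c + (b - (wlen g - c)))%N) t2 Hy y1.
  by lia.
have kt : (e - (c + (b - (wlen g - c))) + t <= 2 * t)%N by lia.
have {rb} := read_atW kt rb; have -> : (b + (e - (c + (b - (wlen g - c)))) = wlen g - c + (e - c))%N by lia.
move=> [u [q [h [Su Hh uq]]]]; case: re => v [q' [h' [Sv Hh' vq]]].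
rewrite fx; last by lia.
rewrite ex; last by lia.
rewrite subnKC; last by lia.
(* Both windows are now at the same place of the same generator. Comparing the prefixes before them
   gives [g * h' = h], with [h] and [h'] in the subgroup. *)
move=> -> -> f1; have [->->] := S_factor Sv Su vq uq f1; rewrite mulgA => /mulIg e5.
by rewrite -[g](mulgK h') e5; apply: Hs.2.
Qed.

End Malnormality.

(** * Sufficient conditions for malnormality in terms of a tuple *)

Section Tuples.
Variable A : finType.
Implicit Types (u v w : seq (letter A)) (x y g : freeGroup A).

Lemma factor_invw n p w : (p + n <= size w)%N ->
  factor n p (invw w) = invw (factor n (size w - (p + n)) w).
Proof.
move=> pn; rewrite /factor /invw drop_rev size_map take_rev -map_take -map_drop.
congr (rev (map _ _)); rewrite size_map size_takel ?leq_subr// take_drop.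
by congr (drop _ (take _ _)); lia.
Qed.

(** Adjoining the inverses to the generators leaves the subgroup unchanged. A factor of [x^-1] is
    the inverse of a factor of [x] at the mirrored place, so a coincidence in the enlarged set
    becomes one between factors of [h], up to inversion. *)
Lemma malnormal_tuple t (h : seq (freeGroup A)) :
  (forall x, x \in h -> (4 * t <= wlen x)%N) ->
  (forall x y p q, x \in h -> y \in h ->
     (p + t <= wlen x)%N -> (q + t <= wlen y)%N ->
     (factor t p (word x) = factor t q (word y) -> x = y /\ p = q) /\
     factor t p (word x) <> invw (factor t q (word y))) ->
  malnormal (generated [set x | x \in h]).
Proof.
move=> long distinct.
pose S := [set x | x \in h \/ x^-1%g \in h].
have -> : generated [set x | x \in h] = generated S.
  apply/seteqP; split; apply: generated_min.
  - exact: generated_subgroup.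
  - by move=> x xh; apply: sub_generated; left.
  - exact: generated_subgroup.
  - move=> x [xh|xh]; first exact: sub_generated.
    rewrite -[x]invgK.
    by apply: (subgroupV (generated_subgroup [set x | x \in h])); exact: sub_generated.
have wlenV x : wlen x^-1%g = wlen x by rewrite /wlen size_invw.
have factorV x p : (p + t <= wlen x)%N ->
    factor t p (word x) = invw (factor t (wlen x - (p + t)) (word x^-1%g)).
  move=> pt; rewrite -[in LHS](invgK x) factor_invw -/(wlen _) ?wlenV//.
apply: (@malnormal_generated _ S t).
- by move=> x [xh|xh]; [right; rewrite invgK|left].
- by move=> x [/long//|/long]; rewrite wlenV.
move=> x y p q [xh|xh] [yh|yh] px qy.
- by have [] := distinct _ _ p q xh yh px qy.
- rewrite (factorV y)// => e; exfalso.
  have [|_] := distinct _ _ p (wlen y - (q + t))%N xh yh px; first by rewrite wlenV; lia.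
  exact.
- rewrite (factorV x)// => /esym e; exfalso.
  have [|_] := distinct _ _ q (wlen x - (p + t))%N yh xh qy; first by rewrite wlenV; lia.
  exact.
- rewrite (factorV x)// (factorV y)// => /(can_inj (@invwK _)) e.
  have [||/(_ e)[/invg_inj exy]] := distinct _ _ (wlen x - (p + t))%N (wlen y - (q + t))%N xh yh.
  - by rewrite wlenV; lia.
  - by rewrite wlenV; lia.
  by subst y => ? _; split=> //; lia.
Qed.

(** Covers the tuples with [max_len h = 0], for which the bound on the failure probability
    vanishes. *)
Lemma malnormal_trivial (h : seq (freeGroup A)) :
  (forall x, x \in h -> wlen x = 0%N) -> malnormal (generated [set x | x \in h]).
Proof.
move=> h0.
have -> : generated [set x | x \in h] = [set 1%g].
  apply/seteqP; split; last by move=> _ ->; exact: (generated_subgroup _).1.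
  apply: generated_min; first by split=> // _ _ -> ->; rewrite mulgV.
  by move=> x /= /h0/size0nil e; apply: val_inj.
move=> g _; apply/seteqP; split=> [y [] //|_ ->]; split=> //.
by exists 1%g; rewrite // mulg1 mulVg.
Qed.

End Tuples.

(** * Real-valued probabilities on a discrete space *)

Section DiscreteProbability.
Variables (R : realType) (d : measure_display) (T : measurableType d).
Hypothesis mT : forall X : set T, measurable X.
Variable P : probability T R.
Implicit Types X Y : set T.

Definition pr X : R := fine (P X).

Lemma prE X : P X = (pr X)%:E.
Proof. by rewrite /pr fineK// fin_num_measure. Qed.

Lemma pr_ge0 X : 0 <= pr X.
Proof. exact/fine_ge0/measure_ge0. Qed.

Lemma pr_le1 X : pr X <= 1.
Proof. by rewrite -lee_fin -prE probability_le1. Qed.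

Lemma pr_set0 : pr set0 = 0.
Proof. by rewrite /pr measure0. Qed.

Lemma le_pr X Y : X `<=` Y -> pr X <= pr Y.
Proof. by move=> XY; rewrite -lee_fin -!prE le_measure// inE. Qed.

Lemma prID X Y : pr X = pr (X `&` Y) + pr (X `&` ~` Y).
Proof.
apply: EFin_inj; rewrite EFinD -!prE -measureU//; first by rewrite -setIUr setUv setIT.
by rewrite setIACA setICr setI0.
Qed.

Lemma pr_sum_le (I : eqType) (s : seq I) X (F : I -> set T) :
  (forall t, X t -> exists2 i, i \in s & F i t) -> pr X <= \sum_(i <- s) pr (F i).
Proof.
elim: s X => [|i s IHs] X XF.
  rewrite big_nil -pr_set0; by apply: le_pr => t /XF[].
rewrite big_cons (prID X (F i)); apply: lerD; first by apply: le_pr => t [].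
apply: IHs => t [/XF[j]]; rewrite inE => /predU1P[-> //|js Fj _].
by exists j.
Qed.

Lemma pr_union_le (I : finType) X (F : I -> set T) (b : R) :
  (forall t, X t -> exists i, F i t) -> (forall i, pr (F i) <= b) ->
  pr X <= #|I|%:R * b.
Proof.
move=> XF Fb; apply: (@le_trans _ _ (\sum_(i <- enum I) pr (F i))).
  by apply: pr_sum_le => t /XF[i Fi]; exists i; rewrite // mem_enum.
apply: (@le_trans _ _ (\sum_(i <- enum I) b)); first exact: ler_sum.
by rewrite big_const_seq count_predT -cardE iter_addr_0 mulr_natl.
Qed.

Lemma sum_pr_fiber (J : eqType) (s : seq J) (f : T -> J) X :
  uniq s -> \sum_(j <- s) pr (X `&` [set t | f t = j]) <= pr X.
Proof.
elim: s X => [|j s IHs] X /=; first by rewrite big_nil pr_ge0.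
move=> /andP[js us]; rewrite big_cons (prID X [set t | f t = j]) lerD2l.
apply: le_trans (IHs _ us); rewrite le_eqVlt; apply/orP; left; apply/eqP.
apply: eq_big_seq => i si; congr pr; apply/seteqP; split=> t.
  by move=> [Xt ft]; split=> //; split=> //= ftj; move: js; rewrite -ftj ft si.
by move=> [[Xt _] ft].
Qed.

Lemma sum_pr_set1 (s : seq T) X :
  (forall t, t \in s -> X t) -> uniq s -> \sum_(t <- s) pr [set t] <= pr X.
Proof.
move=> sX us; apply: le_trans (sum_pr_fiber id X us).
rewrite big_seq [leRHS]big_seq; apply: ler_sum => t ts; apply: le_pr => _ ->; split=> //; exact: sX.
Qed.

End DiscreteProbability.

(** * Coincidences of factors in prefix-heavy random words *)

Section PrefixHeavy.
Variables (R : realType) (A : finType) (C alpha : R).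
Variable Rn : nat -> probability (freeGroup A) R.
Hypothesis heavy : prefix_heavy C alpha Rn.
Hypotheses (C_ge0 : 0 <= C) (alpha_ge0 : 0 <= alpha).
Implicit Types (x y : freeGroup A) (D : set (freeGroup A)).

(** The conditional bound multiplied out; if the prefix [u] has probability zero, both sides
    vanish. *)
Lemma prefix_heavy_le l D u v :
  D `<=` with_prefix (word u ++ word v) ->
  pr (Rn l) D <= C * alpha ^+ wlen v * pr (Rn l) (with_prefix (word u)).
Proof.
move=> Dv; have uv : with_prefix (word u ++ word v) `<=` with_prefix (word u).
  by move=> x /= /prefixP[s e]; rewrite /with_prefix /= e -catA prefix_prefix.
have le_D X : D `<=` X -> pr (Rn l) D <= pr (Rn l) X by exact: le_pr.
have [e|nz] := eqVneq (Rn l (with_prefix (word u))) 0%E.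
  have e' : pr (Rn l) (with_prefix (word u)) = 0 by rewrite /pr e.
  by rewrite e' mulr0 -e'; apply: le_D; apply: subset_trans uv.
have := heavy.2 l u nz v; rewrite /cond_prob setIidl// -/(pr _ _) -/(pr _ _).
have pu : 0 < pr (Rn l) (with_prefix (word u)).
  rewrite lt0r pr_ge0 andbT; apply: contra nz => /eqP e.
  by rewrite prE// e.
by rewrite ler_pdivrMr//; apply: le_trans; exact: le_D.
Qed.

(* Conditioning on the first [q] letters, which determine the next [n]. *)
Lemma pr_determined l q n D :
  (forall x, D x -> (q + n <= wlen x)%N) ->
  (forall x y, D x -> D y -> take q (word x) = take q (word y) ->
     factor n q (word x) = factor n q (word y)) ->
  pr (Rn l) D <= C * alpha ^+ n.
Proof.
move=> Dq Dn; pose s := [seq val t | t <- enum {: q.-tuple (letter A)}].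
have us : uniq s by rewrite map_inj_uniq ?enum_uniq//; exact: val_inj.
pose f x := take q (word x).
apply: (@le_trans _ _ (\sum_(u <- s) pr (Rn l) (D `&` [set x | f x = u]))).
  apply: pr_sum_le => // x Dx; exists (f x) => //.
  have sx : size (f x) == q by rewrite size_takel//; have := Dq _ Dx; rewrite /wlen; lia.
  by apply/mapP; exists (Tuple sx); rewrite ?mem_enum.
apply: (@le_trans _ _ (C * alpha ^+ n * \sum_(u <- s) pr (Rn l) (setT `&` [set x | f x = u]))); last first.
  rewrite -[leRHS]mulr1 ler_wpM2l ?mulr_ge0 ?exprn_ge0//.
  by apply: le_trans (sum_pr_fiber _ _ f setT us) _ => //; exact: pr_le1.
rewrite mulr_sumr; apply: ler_sum => u _; rewrite setTI.
(* A word [x] of [D] beginning with [u] supplies the reduced words [u'] and [v'] to which the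
   hypothesis applies; if there is none, the summand is zero. *)
have [[x [Dx fx]]|no] := pselect (exists x, D x /\ f x = u); last first.
  rewrite (_ : _ `&` _ = set0) ?pr_set0 ?mulr_ge0 ?exprn_ge0 ?pr_ge0//.
  by apply/seteqP; split=> // x [Dx fx]; apply: no; exists x.
have rx := word_reduced x.
pose u' := FreeGroup (reduced_take q rx).
pose v' := FreeGroup (reduced_take n (reduced_drop q rx)).
have qx : (q + n <= size (word x))%N by exact: Dq.
have nv : wlen v' = n by rewrite /wlen /= size_takel// size_drop; lia.
apply: (@le_trans _ _ (C * alpha ^+ n * pr (Rn l) (with_prefix (word u')))).
  rewrite -nv; apply: prefix_heavy_le => y [Dy fy]; rewrite /with_prefix /=.
  have fxy : f x = f y by rewrite fx.
  have := Dn _ _ Dx Dy fxy; rewrite /f in fxy; rewrite fxy /factor => ->.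
  rewrite -takeD; apply/prefixP; exists (drop (q + n) (word y)).
  by rewrite cat_take_drop.
rewrite ler_wpM2l ?mulr_ge0 ?exprn_ge0//; apply: le_pr => // y /= /prefixP[w ew].
by rewrite -fx /f ew take_size_cat// size_takel//; lia.
Qed.

Lemma pr_factor_eq l q n w :
  pr (Rn l) [set x | (q + n <= wlen x)%N /\ factor n q (word x) = w] <= C * alpha ^+ n.
Proof.
by apply: (@pr_determined _ q) => [x []//|x y [_ ->] [_ ->]].
Qed.

(** For [b = true] the case [p = q] is excluded since a factor equals itself. For [b = false] it may
    stay: a non-empty reduced word is never its own inverse. *)
Definition self_overlap n (b : bool) p q : set (freeGroup A) :=
  [set x | [/\ (p + n <= wlen x)%N, (q + n <= wlen x)%N &
     if b then factor n p (word x) = factor n q (word x) /\ p <> q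
     else factor n p (word x) = invw (factor n q (word x))]].

Lemma self_overlapC n b p q : self_overlap n b p q = self_overlap n b q p.
Proof.
suff H p' q' : self_overlap n b p' q' `<=` self_overlap n b q' p'.
  by apply/seteqP; split; exact: H.
move=> x [px qx h]; split=> //; case: b h => [[-> /nesym]//|->].
by rewrite invwK.
Qed.

(** By symmetry [q] is the later place. Either the first [q] letters determine the [n] letters
    there, or the event is empty. *)
Lemma pr_self_overlap l n b p q : (0 < n)%N ->
  pr (Rn l) (self_overlap n b p q) <= C * alpha ^+ n.
Proof.
move=> n0; wlog pq : p q / (p <= q)%N.
  by move=> H; have [/H//|/ltnW/H] := leqP p q; rewrite self_overlapC.
have nthf a0 m k (w : seq (letter A)) : (k < n)%N -> nth a0 (factor n m w) k = nth a0 w (m + k).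
  by move=> kn; rewrite /factor nth_take// nth_drop.
have sf m x : (m + n <= wlen x)%N -> size (factor n m (word x)) = n.
  by move=> mx; rewrite /factor size_takel// size_drop -/(wlen x); lia.
apply: (@pr_determined _ q) => [x []//|x y [px qx hx] [py qy hy] exy].
have [a0 _] : exists a0 : letter A, True.
  by case: (word x) (sf _ _ px) n0 => [|a0 s]; [move=> <-|exists a0].
case: b hx hy => [[fx pnq] [fy _]|fx fy].
  (* Past [q] the word is periodic of period [q - p]. *)
  have H k : (k < q + n)%N -> nth a0 (word x) k = nth a0 (word y) k.
    elim/ltn_ind: k => k IHk kqn; have [kq|qk] := ltnP k q.
      by rewrite -(nth_take a0 kq) exy nth_take.
    have step z : factor n p (word z) = factor n q (word z) ->
        nth a0 (word z) k = nth a0 (word z) (p + (k - q)).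
      move=> fz; have kn : (k - q < n)%N by lia.
      by rewrite -(nthf a0 p _ _ kn) fz nthf// subnKC.
    by rewrite (step x fx) (step y fy); apply: IHk; lia.
  apply: (@eq_from_nth _ a0); first by rewrite !sf.
  by move=> k; rewrite sf// => kn; rewrite !nthf//; apply: H; lia.
have [pnq|qpn] := leqP (p + n) q.
  have H x' : (q + n <= wlen x')%N ->
      factor n p (take q (word x')) = factor n p (word x').
    by move=> qx'; rewrite -[take q _]cats0 factor_cat_take// (leq_trans _ qx')// leq_addr.
  have E : factor n p (word x) = factor n p (word y) by rewrite -H// exy H.
  by apply: (can_inj (@invwK A)); rewrite -fx -fy.
(* The two places overlap, so [x] would coincide with its inverse at the centre
   of their union. *)
exfalso.
(* Matching the factor at [p] with the inverse of the one at [q] exchanges positions of sum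
   [p + q + n - 1]; [i] and [j] are the two most central ones. *)
pose j := ((p + q + n) %/ 2)%N; pose i := (p + q + n - 1 - j)%N.
apply: (@reduced_center A a0 (word x) i j (word_reduced x)).
- by rewrite /i /j; lia.
- by rewrite -/(wlen x) /j; lia.
have jn : (j - q < n)%N by rewrite /j; lia.
have qj : (q <= j)%N by rewrite /j; lia.
rewrite -{1}(subnKC qj) -(nthf a0 q _ _ jn) -[factor n q _]invwK -fx.
rewrite nth_invw ?sf// nthf; last by lia.
by congr (linv (nth _ _ _)); rewrite /i; lia.
Qed.

End PrefixHeavy.

(** * Random tuples: independence given the lengths, and the failure bound *)

Lemma words_of_length (A : finType) n :
  exists s : seq (freeGroup A), uniq s /\ (forall x, (x \in s) = (wlen x == n)).
Proof.
exists (pmap insub [seq val t | t <- enum {: n.-tuple (letter A)}]); split.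
  by apply: pmap_sub_uniq; rewrite map_inj_uniq ?enum_uniq//; exact: val_inj.
move=> x; rewrite mem_pmap_sub; apply/mapP/eqP => [[t _ e]|/eqP xn].
  by rewrite /wlen -[word x]/(val x) e size_tuple.
by exists (Tuple xn); rewrite ?mem_enum.
Qed.

Section RandomTuples.
Variables (R : realType) (A : finType).
Variables (Tn : probability (seq nat) R) (Rn : nat -> probability (freeGroup A) R).
Variable Pn : probability (seq (freeGroup A)) R.
Hypothesis PnE : forall h : seq (freeGroup A),
  Pn [set h] = (Tn [set map (@wlen A) h] * \prod_(x <- h) Rn (wlen x) [set x])%E.
Implicit Types (l : seq nat) (h : seq (freeGroup A)) (D : nat -> set (freeGroup A)).

Lemma pr_tupleE h : pr Pn [set h] =
  pr Tn [set map (@wlen A) h] * \prod_(x <- h) pr (Rn (wlen x)) [set x].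
Proof.
apply: EFin_inj; rewrite EFinM -!prE// PnE; congr (_ * _)%E.
by elim/big_rec2: _ => // x a b _ ->; rewrite EFinM -prE.
Qed.

(** Product events for fixed lengths; their bound [pr_box_le] is the form in which independence of
    the words is used. *)
Definition box l D : set (seq (freeGroup A)) :=
  [set h | map (@wlen A) h = l /\ forall i, (i < size l)%N -> D i (nth 1%g h i)].

(** For fixed lengths a box is finite. Enumerating it coordinate by coordinate turns the sum of
    products into a product of sums. *)
Lemma box_enum l D : exists s : seq (seq (freeGroup A)),
  [/\ forall h, box l D h -> h \in s, forall h, h \in s -> map (@wlen A) h = l &
    \sum_(h <- s) \prod_(x <- h) pr (Rn (wlen x)) [set x] <=
    \prod_(i < size l) pr (Rn (nth 0%N l i)) (D i)].
Proof.
elim: l D => [|n l IHl] D.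
  exists [:: [::]]; split=> [[|x h] []//|h|]; first by rewrite inE => /eqP ->.
  by rewrite big_seq1 big_nil big_ord0.
have [s [boxs slen sle]] := IHl (fun i => D i.+1).
have [w [uw mw]] := words_of_length A n.
pose w' := [seq x <- w | `[< D 0%N x >]].
exists [seq x :: h | x <- w', h <- s]; split.
- move=> [|x h] [//= [xn hl] hD]; apply: allpairs_f.
    by rewrite mem_filter mw xn eqxx andbT; apply/asboolP; exact: (hD 0%N).
  by apply: boxs; split=> // i il; exact: (hD i.+1).
- move=> _ /allpairsP[[x h] /= [xw hs ->]] /=.
  by rewrite slen//; move: xw; rewrite mem_filter mw => /andP[_ /eqP ->].
rewrite big_allpairs_dep /= big_ord_recl /=.
under eq_bigr do (under eq_bigr do rewrite big_cons; rewrite -mulr_sumr).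
rewrite -mulr_suml ler_pM//.
- by apply: sumr_ge0 => x _; exact: pr_ge0.
- by apply: sumr_ge0 => h _; apply: prodr_ge0 => x _; exact: pr_ge0.
rewrite [leLHS](_ : _ = \sum_(x <- w') pr (Rn n) [set x]).
  apply: sum_pr_set1 => //; last exact: filter_uniq.
  by move=> x; rewrite mem_filter => /andP[/asboolP].
apply: eq_big_seq => x; rewrite mem_filter mw => /andP[_ /eqP ->//].
Qed.

Lemma pr_box_le l D : pr Pn (box l D) <=
  pr Tn [set l] * \prod_(i < size l) pr (Rn (nth 0%N l i)) (D i).
Proof.
have [s [boxs slen sle]] := box_enum l D.
apply: (@le_trans _ _ (\sum_(h <- s) pr Pn [set h])).
  by apply: pr_sum_le => // h /boxs hs; exists h.
rewrite (eq_big_seq (fun h => pr Tn [set l] * \prod_(x <- h) pr (Rn (wlen x)) [set x])).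
  by rewrite -mulr_sumr ler_wpM2l// pr_ge0.
by move=> h hs; rewrite pr_tupleE slen.
Qed.

Lemma pr_lengths_le l : pr Pn [set h | map (@wlen A) h = l] <= pr Tn [set l].
Proof.
apply: le_trans (_ : pr Pn (box l (fun=> setT)) <= _).
  by apply: le_pr => // h hl; split.
apply: le_trans (pr_box_le _ _) _; rewrite -[leRHS]mulr1 ler_wpM2l ?pr_ge0//.
by apply: prodr_ile1 => i _; rewrite pr_ge0 pr_le1.
Qed.

Lemma pr_coord_le l i (D : set (freeGroup A)) : (i < size l)%N ->
  pr Pn [set h | map (@wlen A) h = l /\ D (nth 1%g h i)] <=
  pr Tn [set l] * pr (Rn (nth 0%N l i)) D.
Proof.
move=> il; pose D' k := if k == i then D else setT.
apply: le_trans (_ : pr Pn (box l D') <= _).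
  apply: le_pr => // h [hl hD]; split=> // k kl; rewrite /D'.
  by case: eqP => // ->.
apply: le_trans (pr_box_le _ _) _; rewrite ler_wpM2l ?pr_ge0//.
rewrite (bigD1 (Ordinal il))//= {1}/D' eqxx -[leRHS]mulr1 ler_wpM2l ?pr_ge0//.
by apply: prodr_ile1 => k _; rewrite pr_ge0 pr_le1.
Qed.

Lemma pr_coord2_le l i j (D E : set (freeGroup A)) :
  (i < size l)%N -> (j < size l)%N -> i != j ->
  pr Pn [set h | [/\ map (@wlen A) h = l, D (nth 1%g h i) & E (nth 1%g h j)]] <=
  pr Tn [set l] * (pr (Rn (nth 0%N l i)) D * pr (Rn (nth 0%N l j)) E).
Proof.
move=> il jl ij; pose D' k := if k == i then D else if k == j then E else setT.
apply: le_trans (_ : pr Pn (box l D') <= _).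
  apply: le_pr => // h [hl hD hE]; split=> // k kl; rewrite /D'.
  by case: eqP => [->//|_]; case: eqP => // ->.
apply: le_trans (pr_box_le _ _) _; rewrite ler_wpM2l ?pr_ge0//.
rewrite (bigD1 (Ordinal il))//= {1}/D' eqxx ler_wpM2l ?pr_ge0//.
rewrite (bigD1 (Ordinal jl))/=; last by rewrite -val_eqE /= eq_sym.
rewrite /D' [j == i]eq_sym (negPf ij) eqxx -[leRHS]mulr1 ler_wpM2l ?pr_ge0//.
by apply: prodr_ile1 => k _; rewrite pr_ge0 pr_le1.
Qed.

Variables C alpha : R.
Hypotheses (C_ge1 : 1 <= C) (alpha_gt0 : 0 < alpha) (alpha_lt1 : alpha < 1).
Hypothesis heavy : prefix_heavy C alpha Rn.

Let C_ge0 : 0 <= C. Proof. exact: le_trans C_ge1. Qed.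
Let alpha_ge0 : 0 <= alpha. Proof. exact: ltW. Qed.

Definition overlap n (b : bool) i j p q : set (seq (freeGroup A)) :=
  [set h | let x := nth 1%g h i in let y := nth 1%g h j in
    [/\ (p + n <= wlen x)%N, (q + n <= wlen y)%N &
      if b then factor n p (word x) = factor n q (word y) /\ (i, p) <> (j, q)
      else factor n p (word x) = invw (factor n q (word y))]].

(** For [i = j] this is a coincidence within one word. Otherwise split by the value [v] of the
    factor of the second word: by independence each term is at most [C * alpha ^+ n] times the
    probability that the first word carries [v], or its inverse, at [p], and these probabilities add
    up to at most 1. *)
Lemma pr_overlap_le l n b i j p q : (0 < n)%N -> (i < size l)%N -> (j < size l)%N ->
  pr Pn [set h | map (@wlen A) h = l /\ overlap n b i j p q h] <=
  pr Tn [set l] * (C * alpha ^+ n).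
Proof.
move=> n0 il jl; have [<-|ij] := eqVneq i j.
  have sub : [set h | map (@wlen A) h = l /\ overlap n b i i p q h] `<=`
      [set h | map (@wlen A) h = l /\ self_overlap n b p q (nth 1%g h i)].
    move=> h [hl [pi qi hb]]; split=> //; split=> //.
    by case: b hb => // -[e pq]; split=> // epq; apply: pq; rewrite epq.
  apply: le_trans (le_pr _ _ sub) _ => //.
  apply: le_trans (pr_coord_le _ il) _; rewrite ler_wpM2l ?pr_ge0//.
  exact: pr_self_overlap.
pose sg (v : seq (letter A)) := if b then v else invw v.
have sgK : involutive sg by rewrite /sg; case: (b) => // v; exact: invwK.
pose s := [seq val v | v <- enum {: n.-tuple (letter A)}].
have us : uniq s by rewrite map_inj_uniq ?enum_uniq//; exact: val_inj.
pose X := [set x : freeGroup A | (p + n <= wlen x)%N].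
pose D v := X `&` [set x | sg (factor n p (word x)) = v].
pose E v := [set x : freeGroup A | (q + n <= wlen x)%N /\ factor n q (word x) = v].
apply: (@le_trans _ _ (\sum_(v <- s) pr Pn
    [set h | [/\ map (@wlen A) h = l, D v (nth 1%g h i) & E v (nth 1%g h j)]])).
  apply: pr_sum_le => // h [hl [pi qj hb]].
  exists (factor n q (word (nth 1%g h j))).
    have sq : size (factor n q (word (nth 1%g h j))) == n.
      by rewrite /factor size_takel// size_drop -/(wlen _); lia.
    by apply/mapP; exists (Tuple sq); rewrite ?mem_enum.
  split=> //; split=> //=; rewrite -[RHS]sgK; congr sg.
  by rewrite /sg; case: (b) hb => // -[].
apply: (@le_trans _ _ (\sum_(v <- s) pr Tn [set l] * (C * alpha ^+ n) *
    pr (Rn (nth 0%N l i)) (D v))).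
  apply: ler_sum => v _; apply: le_trans (pr_coord2_le _ _ il jl ij) _.
  rewrite -mulrA ler_wpM2l ?pr_ge0// mulrC ler_wpM2r ?pr_ge0//.
  exact: pr_factor_eq.
rewrite -mulr_sumr -[leRHS]mulr1 ler_wpM2l ?mulr_ge0 ?pr_ge0 ?exprn_ge0//.
by apply: le_trans (sum_pr_fiber _ _ _ X us) _ => //; exact: pr_le1.
Qed.

(** Union bound: a failure forces an overlap, described by the flag, two indices below [size l] and
    two positions below [L]. *)
Lemma pr_not_malnormal_le l t L : (0 < t)%N ->
  (forall k, k \in l -> (4 * t <= k <= L)%N) ->
  pr Pn [set h | map (@wlen A) h = l /\ ~ generates_malnormal h] <=
  (2 * (size l ^ 2 * L ^ 2))%:R * (pr Tn [set l] * (C * alpha ^+ t)).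
Proof.
move=> t0 lL; pose I := (bool * ('I_(size l) * 'I_(size l)) * ('I_L * 'I_L))%type.
have -> : (2 * (size l ^ 2 * L ^ 2))%N = #|{: I}|.
  by rewrite !card_prod card_bool !card_ord; lia.
pose F (e : I) := [set h | map (@wlen A) h = l /\
  overlap t e.1.1 e.1.2.1 e.1.2.2 e.2.1 e.2.2 h].
apply: (@pr_union_le _ _ _ _ _ _ _ F) => // [h [hl hm]|[[b [i j]] [p q]]]; last first.
  exact: pr_overlap_le.
have wl x : x \in h -> (4 * t <= wlen x <= L)%N.
  by move=> xh; apply: lL; rewrite -hl map_f.
have sh : size l = size h by rewrite -hl size_map.
apply: contra_notP hm => no; apply: (@malnormal_tuple _ t).
  by move=> x /wl /andP[].
move=> x y p q xh yh px qy.
(* Each word is represented by its first index in [h], so a word repeated in the tuple does not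
   count as an overlap with itself. *)
have noF b : ~ overlap t b (index x h) (index y h) p q h.
  move=> o; apply: no.
  have il : (index x h < size l)%N by rewrite sh index_mem.
  have jl : (index y h < size l)%N by rewrite sh index_mem.
  have pL : (p < L)%N by have := wl _ xh; lia.
  have qL : (q < L)%N by have := wl _ yh; lia.
  by exists (b, (Ordinal il, Ordinal jl), (Ordinal pL, Ordinal qL)).
have [nx ny] : nth 1%g h (index x h) = x /\ nth 1%g h (index y h) = y.
  by split; exact: nth_index.
split=> [e|e]; last by apply: (noF false); split; rewrite ?nx ?ny.
have [[eij ->]|ne] := pselect ((index x h, p) = (index y h, q)).
  by rewrite -nx eij ny.
by exfalso; apply: (noF true); split; rewrite ?nx ?ny.
Qed.

Lemma pr_not_malnormal l k L m : k = size l -> L = (\max_(i <- l) i)%N ->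
  m = (\big[minn/L]_(i <- l) i)%N ->
  pr Pn [set h | map (@wlen A) h = l /\ ~ generates_malnormal h] <=
  2 * C / alpha * (k%:R ^+ 2 * L%:R ^+ 2 * alpha `^ (m%:R / 8)) * pr Tn [set l].
Proof.
move=> ek eL em.
have lL i : i \in l -> (m <= i <= L)%N.
  move=> il; apply/andP; split; last by rewrite eL; exact: (@leq_bigmax_seq _ l xpredT id i).
  rewrite em; elim: (l) il {eL em ek} => // i' l' IHl; rewrite inE big_cons geq_min.
  by move=> /predU1P[->|/IHl ->]; rewrite ?leqnn ?orbT.
have c_ge0 : 0 <= 2 * C / alpha by rewrite !mulr_ge0 ?invr_ge0.
(* If [L = 0] all words are empty: the right-hand side is zero, and no tuple fails. *)
have [L0|L0] := posnP L.
  rewrite (_ : [set h | _] = set0).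
    by rewrite pr_set0 !mulr_ge0 ?pr_ge0 ?powR_ge0 ?exprn_ge0 ?invr_ge0.
  apply/seteqP; split=> // h [hl] [] /=; apply: malnormal_trivial => x xh.
  by have := lL (wlen x); rewrite -hl map_f// L0 => /(_ isT); lia.
have k0 : (0 < k)%N by rewrite ek lt0n size_eq0; apply: contraTneq L0 => el; rewrite eL el big_nil.
have ia : 1 <= alpha^-1 by rewrite invf_ge1// ltW.
(* For [m < 4] the right-hand side exceeds [pr Tn [set l]]; this is what the
   factor [1 / alpha] is for. *)
have [m4|m4] := ltnP m 4.
  apply: le_trans (_ : pr Pn [set h | map (@wlen A) h = l] <= _).
    by apply: le_pr => // h [].
  apply: le_trans (pr_lengths_le l) _; rewrite -[leLHS]mul1r ler_wpM2r ?pr_ge0//.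
  have kL1 : 1 <= k%:R ^+ 2 * L%:R ^+ 2 :> R.
    by rewrite -!natrX -natrM ler1n muln_gt0 !expn_gt0 k0 L0.
  have am : alpha <= alpha `^ (m%:R / 8).
    rewrite -{1}[alpha]powRr1//; apply: ger_powR; first by rewrite alpha_gt0 ltW.
    by rewrite ler_pdivrMr// mul1r (ler_nat R m 8); lia.
  apply: le_trans (_ : 2 * C / alpha * (1 * alpha) <= _); last first.
    by rewrite ler_wpM2l// ler_pM.
  rewrite mul1r divfK ?gt_eqF//; apply: (le_trans C_ge1).
  by rewrite ler_peMl ?ler1n.
(* Here [t] is [m %/ 4], positive since [m >= 4]. Rounding down costs at most half of [m / 4], which
   accounts for the exponent [m / 8]. *)
have lm i : i \in l -> (4 * (m %/ 4) <= i <= L)%N by move=> /lL; lia.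
apply: le_trans (pr_not_malnormal_le _ lm) _; first by rewrite divn_gt0.
have -> : (2 * (size l ^ 2 * L ^ 2))%:R = 2 * (k%:R ^+ 2 * L%:R ^+ 2) :> R.
  by rewrite ek natrM natrM !natrX.
set X := k%:R ^+ 2 * _; set Y := powR _ _.
have aY : alpha ^+ (m %/ 4) <= Y.
  rewrite -powR_mulrn//; apply: ger_powR; first by rewrite alpha_gt0 ltW.
  rewrite ler_pdivrMr// -natrM ler_nat; lia.
rewrite (_ : 2 * X * _ = 2 * C * X * pr Tn [set l] * alpha ^+ (m %/ 4)); last by lra.
rewrite (_ : 2 * C / alpha * _ * _ = 2 * C * X * pr Tn [set l] * (alpha^-1 * Y)); last by lra.
have Xge0 : 0 <= X by rewrite mulr_ge0 ?exprn_ge0.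
rewrite ler_wpM2l ?mulr_ge0 ?pr_ge0//; apply: le_trans aY _.
by rewrite -[leLHS]mul1r ler_wpM2r ?powR_ge0.
Qed.

(* Countable additivity over the vectors of lengths. *)
Lemma pr_le_lengths (X : set (seq (freeGroup A))) (c : R) : 0 <= c ->
  (forall l, pr Pn [set h | map (@wlen A) h = l /\ X h] <= c * pr Tn [set l]) ->
  pr Pn X <= c.
Proof.
move=> c0 Xc; pose F n := [set h | pickle (map (@wlen A) h) = n /\ X h].
pose G n := [set l : seq nat | pickle l = n].
have FG n : pr Pn (F n) <= c * pr Tn (G n).
  have [[l ln]|no] := pselect (exists l : seq nat, pickle l = n).
    have -> : F n = [set h | map (@wlen A) h = l /\ X h].
      rewrite /F -ln; apply/seteqP; split=> h [e Xh]; split=> //; last by rewrite e.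
      exact: (pcan_inj pickleK).
    rewrite (_ : G n = [set l])//; apply/seteqP; split=> [l' /= e|_ ->//].
    by apply: (pcan_inj (@pickleK _)); rewrite e.
  rewrite (_ : F n = set0) ?pr_set0 ?mulr_ge0 ?pr_ge0//.
  by apply/seteqP; split=> // h [e _]; apply: no; eexists; exact: e.
have mP (Y : set (seq (freeGroup A))) : measurable Y by [].
rewrite -lee_fin -prE//.
apply: (@le_trans _ _ (\sum_(n <oo) Pn (F n))%E).
  by apply: measure_sigma_subadditive => // h Xh; exists (pickle (map (@wlen A) h)).
apply: (@le_trans _ _ (\sum_(n <oo) (c%:E * Tn (G n)))%E).
  by apply: lee_nneseries => // n _; rewrite !prE// -EFinM lee_fin.
rewrite nneseriesZl//= -measure_semi_bigcup//; last first.
  by apply/trivIsetP => i j _ _ ij; apply/seteqP; split=> // l [ei ej]; move: ij; rewrite -ei -ej eqxx.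
by rewrite -[leRHS]mule1 lee_wpmul2l ?lee_fin//; exact: probability_le1.
Qed.

(** The quantity compared with [eta] depends only on the lengths. For a given vector of lengths the
    event is thus empty, or its probability is bounded by [pr_not_malnormal] with that quantity at
    most [eta]. *)
Lemma pr_tuple_not_malnormal (eta : R) : 0 <= eta ->
  pr Pn [set h | (size h)%:R ^+ 2 * (max_len h)%:R ^+ 2 *
                   alpha `^ ((min_len h)%:R / 8) <= eta /\ ~ generates_malnormal h] <=
  2 * C / alpha * eta.
Proof.
move=> eta0; have c_ge0 : 0 <= 2 * C / alpha by rewrite !mulr_ge0 ?invr_ge0.
apply: pr_le_lengths => [|l]; first exact: mulr_ge0.
pose k := size l; pose L := (\max_(i <- l) i)%N; pose m := (\big[minn/L]_(i <- l) i)%N.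
have hE h : map (@wlen A) h = l -> [/\ size h = k, max_len h = L & min_len h = m].
  move=> hl; have eL : max_len h = L by rewrite /max_len /L -hl big_map.
  split=> //; first by rewrite /k -hl size_map.
  by rewrite /min_len eL /m -[in RHS]hl big_map.
have [le|lt] := leP (k%:R ^+ 2 * L%:R ^+ 2 * alpha `^ (m%:R / 8)) eta; last first.
  rewrite (_ : [set h | _] = set0) ?pr_set0 ?mulr_ge0 ?pr_ge0 ?invr_ge0//.
  apply/seteqP; split=> // h [/hE[eh eL em] [+ _]]; by rewrite eh eL em leNgt lt.
apply: (@le_trans _ _ (pr Pn [set h | map (@wlen A) h = l /\ ~ generates_malnormal h])).
  by apply: le_pr => // h [hl []].
by apply: le_trans (pr_not_malnormal erefl erefl erefl) _; rewrite ler_wpM2r ?pr_ge0// ler_wpM2l.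
Qed.

End RandomTuples.

(** * Rates of convergence under linear domination *)

Section Smallness.
Variable R : realType.
Implicit Types f g s : nat -> R.

Lemma littleo_le_lin f g e s (K : R) : 0 < K ->
  (forall n, 0 <= f n <= g n + K * e n) ->
  g =o_\oo s -> e =o_\oo s -> f =o_\oo s.
Proof.
move=> K0 fge /eqoP gs /eqoP es; apply/eqoP => eps eps0.
have := gs (eps / 2); have := es (eps / 2 / K).
rewrite !divr_gt0// => /(_ isT) es' /(_ isT) gs'.
apply: filterS2 gs' es' => n /= gn en; have /andP[f0 fn] := fge n.
rewrite ger0_norm//; apply: (le_trans fn).
rewrite [eps in leRHS](splitr eps) mulrDl; apply: lerD; first exact: le_trans (ler_norm _) gn.
apply: (@le_trans _ _ (K * (eps / 2 / K * `|s n|))).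
  by rewrite ler_pM2l//; exact: le_trans (ler_norm _) en.
by rewrite mulrA [K * _]mulrC divfK ?gt_eqF.
Qed.

Lemma littleoW f s s' : (\forall n \near \oo, `|s n| <= `|s' n|) ->
  f =o_\oo s -> f =o_\oo s'.
Proof.
move=> ss' /eqoP fs; apply/eqoP => eps eps0.
apply: filterS2 ss' (fs _ eps0) => n /= sn fn; apply: (le_trans fn).
by rewrite ler_pM2l.
Qed.

Lemma littleo_invX f (d d' : nat) : (d' <= d)%N ->
  f =o_\oo (fun n => (n%:R ^- d : R)) -> f =o_\oo (fun n => (n%:R ^- d' : R)).
Proof.
move=> dd'; apply: littleoW; exists 1%N => // n /= n1.
have n0 k : 0 < n%:R ^+ k :> R by rewrite exprn_gt0// ltr0n.
rewrite !ger0_norm ?invr_ge0 ?(ltW (n0 _))// lef_pV2 ?posrE//.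
by rewrite ler_weXn2l// ler1n.
Qed.

Lemma littleo_expR f (d d' : R) : d' <= d ->
  f =o_\oo (fun n => expR (- d * n%:R)) ->
  f =o_\oo (fun n => expR (- d' * n%:R)).
Proof.
move=> dd'; apply: littleoW; apply: nearW => n.
by rewrite !ger0_norm ?expR_ge0// ler_expR ler_wpM2r// lerN2.
Qed.

Variables (f g e : nat -> R) (K : R).
Hypotheses (K_gt0 : 0 < K) (fge : forall n, 0 <= f n <= g n + K * e n).

Lemma tends_to_0_le_lin : tends_to_0 g -> tends_to_0 e -> tends_to_0 f.
Proof.
move=> g0 e0; apply: (squeeze_cvgr (f := fun=> 0) (h := fun n => g n + K * e n)).
- exact: nearW.
- exact: cvg_cst.
- rewrite -[X in _ --> X]addr0; apply: cvgD g0 _.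
  by rewrite -(mulr0 K); exact: cvgM (cvg_cst K) e0.
Qed.

Lemma polynomially_small_le_lin :
  polynomially_small g -> polynomially_small e -> polynomially_small f.
Proof.
move=> [g0 [d d0 gd]] [e0 [d' d'0 ed']]; split; first exact: tends_to_0_le_lin.
(* The sum decays at the slower of the two rates, given by the smaller exponent. *)
exists (minn d d'); first by rewrite leq_min d0.
apply: (littleo_le_lin K_gt0 fge).
  exact: littleo_invX (geq_minl _ _) gd.
exact: littleo_invX (geq_minr _ _) ed'.
Qed.

Lemma super_polynomially_small_le_lin : super_polynomially_small g ->
  super_polynomially_small e -> super_polynomially_small f.
Proof.
move=> [g0 gd] [e0 ed]; split=> [|d d0]; first exact: tends_to_0_le_lin.
exact: littleo_le_lin K_gt0 fge (gd d d0) (ed d d0).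
Qed.

Lemma exponentially_small_le_lin :
  exponentially_small g -> exponentially_small e -> exponentially_small f.
Proof.
move=> [g0 [d d0 gd]] [e0 [d' d'0 ed']]; split; first exact: tends_to_0_le_lin.
exists (Num.min d d'); first by rewrite lt_min d0.
apply: (littleo_le_lin K_gt0 fge).
  by apply: littleo_expR gd; rewrite ge_min lexx.
by apply: littleo_expR ed'; rewrite ge_min lexx orbT.
Qed.

End Smallness.

Theorem theorem3p19 (R : realType) (A : finType) (A_gt0 : (0 < #|A|)%N)
    (C alpha : R) (C_ge1 : 1 <= C) (alpha_gt0 : 0 < alpha)
    (alpha_lt1 : alpha < 1)
    (P : nat -> probability (seq (freeGroup A)) R)
    (P_heavy : prefix_heavy_tuples C alpha P)
    (eta : nat -> R) (eta_gt0 : forall n, 0 < eta n) :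
  let q n : R :=
    fine (P n [set h | eta n < (size h)%:R ^+ 2 * (max_len h)%:R ^+ 2 *
                               alpha `^ ((min_len h)%:R / 8)]) in
  [/\ tends_to_0 q -> tends_to_0 eta ->
        generically P (@generates_malnormal A),
      polynomially_small q -> polynomially_small eta ->
        polynomially_generically P (@generates_malnormal A),
      super_polynomially_small q -> super_polynomially_small eta ->
        super_polynomially_generically P (@generates_malnormal A)
    & exponentially_small q -> exponentially_small eta ->
        exponentially_generically P (@generates_malnormal A)].
Proof.
move=> q; have [T [Rn [_ heavy PE]]] := P_heavy.
have K0 : 0 < 2 * C / alpha by rewrite divr_gt0// mulr_gt0// (lt_le_trans _ C_ge1).
have fail n : 0 <= failure_prob P (@generates_malnormal A) n <=
    q n + 2 * C / alpha * eta n.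
  pose X := ~` @generates_malnormal A.
  rewrite -[failure_prob _ _ _]/(pr (P n) X) pr_ge0 /=.
  pose Y := [set h : seq (freeGroup A) | eta n <
    (size h)%:R ^+ 2 * (max_len h)%:R ^+ 2 * alpha `^ ((min_len h)%:R / 8)].
  (* Failures are split according to whether the statistic exceeds [eta n]: the first part is
     contained in the event of [q n], the second is bounded by a multiple of [eta n]. *)
  rewrite (@prID _ _ _ _ _ X Y)//; apply: lerD.
    by apply: le_pr => // h [].
  apply: le_trans (pr_tuple_not_malnormal (PE n) C_ge1 alpha_gt0 alpha_lt1 heavy (ltW (eta_gt0 n))).
  by apply: le_pr => // h [Xh /negP]; rewrite -leNgt.
split.
- exact: tends_to_0_le_lin fail.
- exact: polynomially_small_le_lin K0 fail.
- exact: super_polynomially_small_le_lin K0 fail.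
- exact: exponentially_small_le_lin K0 fail.
Qed.
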